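(* Let $(X,\mathcal{A},\mu)$ be a measure space with $\mu(X)=\infty$ and let $I$ be an ideal (not necessarily proper) in $\mathcal{M}(X,\mathcal{A})$. Equip $\mathcal{M}(X,\mathcal{A})$ with the $U^I_{\mu,F}$-topology. Then: (1) Any additive subgroup of $\mathcal{M}(X,\mathcal{A})$ containing $I$ is clopen. (2) $I\cap L^\infty_F(X,\mathcal{A},\mu)$ is clopen. (3) $I\cap L^\infty_F(X,\mathcal{A},\mu)$ is the connected component of $0$.
   Context: $X$ is a non-empty set, $\mathcal{A}$ a $\sigma$-algebra on $X$, $\mu:\mathcal{A}\to[0,\infty]$ a measure. $\mathcal{M}(X,\mathcal{A})$ is the commutative ring of all measurable functions $X\to\mathbb{R}$ under pointwise operations. A $\mu$-finite set is a set $E\in\mathcal{A}$ with $\mu(E)<\infty$. For an ideal $I$, $f\in\mathcal{M}(X,\mathcal{A})$ and real $\epsilon>0$, put $U_{\mu,F}(f,I,\epsilon)=\{g\in\mathcal{M}(X,\mathcal{A}): f-g\in I$ and there is a $\mu$-finite set $E$ with $\sup_{x\in X\setminus E}|f(x)-g(x)|<\epsilon\}$. These sets form an open base of the $U^I_{\mu,F}$-topology on $\mathcal{M}(X,\mathcal{A})$. A function $f\in\mathcal{M}(X,\mathcal{A})$ is weakly essentially bounded if there is a $\mu$-finite set $E$ such that $f$ is bounded on $X\setminus E$; $L^\infty_F(X,\mathcal{A},\mu)$ is the set of all weakly essentially bounded $f\in\mathcal{M}(X,\mathcal{A})$. *)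

(* Defs.v *)
From HB Require Import structures.
From mathcomp Require Import all_boot all_order all_algebra.
From mathcomp Require Import lra.
From mathcomp Require Import all_classical all_reals all_analysis measurable_realfun.

Set Implicit Arguments.
Unset Strict Implicit.
Unset Printing Implicit Defensive.

Import Order.TTheory GRing.Theory Num.Theory.
Import numFieldNormedType.Exports.

Local Open Scope classical_set_scope.
Local Open Scope ring_scope.

(* Not necessarily proper, unlike the [idealr_closed] of MathComp. *)
Record ideal (A : comNzRingType) := Ideal {
  ideal_set :> set A;
  ideal0 : ideal_set 0;
  idealD : forall f g, ideal_set f -> ideal_set g -> ideal_set (f + g);
  idealM : forall h f, ideal_set f -> ideal_set (h * f) }.

Section UF.
Context (d : measure_display) (T : measurableType d) (R : realType).
Variable mu : {measure set T -> \bar R}.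

Definition mu_finite (E : set T) := measurable E /\ (mu E < +oo)%E.

Definition weakly_ess_bounded (f : {mfun T >-> R}) :=
  exists2 E, mu_finite E & [bounded f x | x in ~` E].

Definition LinftyF : set {mfun T >-> R} := [set f | weakly_ess_bounded f].

(* The supremum is taken in the extended reals, because the real-valued [sup]
   of an unbounded set is 0. *)
Definition UF_ball (I : set {mfun T >-> R}) (f : {mfun T >-> R}) (eps : R) :
    set {mfun T >-> R} :=
  [set g | I (f - g) /\ exists2 E, mu_finite E &
    (ereal_sup [set `|f x - g x|%:E | x in ~` E] < eps%:E)%E].

Definition UF_base (I : set {mfun T >-> R}) : set (set {mfun T >-> R}) :=
  [set B | exists f eps, 0 < eps /\ B = UF_ball I f eps].

Lemma mu_finite0 : mu_finite set0.
Proof. by split; [exact: measurable0|rewrite measure0 ltry]. Qed.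

Lemma mu_finiteU (E F : set T) :
  mu_finite E -> mu_finite F -> mu_finite (E `|` F).
Proof.
move=> [mE Eoo] [mF Foo]; split; first exact: measurableU.
apply: le_lt_trans (lte_add_pinfty Eoo Foo).
exact: measureU2.
Qed.

Lemma UF_ballP I f eps g : UF_ball I f eps g <->
  I (f - g) /\ exists2 E, mu_finite E &
    exists2 s, s < eps & forall x, ~ E x -> `|f x - g x| <= s.
Proof.
split=> -[Ifg [E Efin]].
  move=> sup_lt; split=> //; exists E => //.
  have ub x : ~ E x -> (`|f x - g x|%:E <=
      ereal_sup [set `|f x - g x|%:E | x in ~` E])%E.
    by move=> nEx; apply: ereal_sup_ubound; exists x.
  move: sup_lt ub; case: ereal_sup => [s| |] //.
    by rewrite lte_fin => s_lt ub; exists s => // x /ub; rewrite lee_fin.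
  move=> _ ub; exists (eps - 1); first by lra.
  by move=> x /ub; rewrite leeNy_eq.
move=> [s s_lt ub]; split=> //; exists E => //.
apply: (@le_lt_trans _ _ s%:E); last by rewrite lte_fin.
by apply: ge_ereal_sup => _ [x nEx <-]; rewrite lee_fin; exact: ub.
Qed.

Lemma UF_base_cover (I : ideal {mfun T >-> R}) :
  \bigcup_(B in UF_base I) B = setT.
Proof.
rewrite -subTset => f _; exists (UF_ball I f 1); first by exists f, 1.
apply/UF_ballP; split; first by rewrite subrr; exact: ideal0.
exists set0; first exact: mu_finite0.
by exists 0 => // x _; rewrite subrr normr0.
Qed.

Lemma UF_ball_sub (I : ideal {mfun T >-> R}) f eps g : UF_ball I f eps g ->
  exists2 del, 0 < del & forall e, e <= del -> UF_ball I g e `<=` UF_ball I f eps.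
Proof.
move=> /UF_ballP[Ifg [E Efin [s s_lt fg]]].
exists (eps - s) => [|e e_le h /UF_ballP[Igh [F Ffin [r r_lt gh]]]]; first by lra.
apply/UF_ballP; split.
  by rewrite -(subrKA g); exact: idealD.
exists (E `|` F); first exact: mu_finiteU.
exists (s + r) => [|x /not_orP[nEx nFx]]; first by lra.
by rewrite -(subrKA (g x)) (le_trans (ler_normD _ _))// lerD// ?fg// gh.
Qed.

Lemma UF_base_join (I : ideal {mfun T >-> R}) A B g :
  UF_base I A -> UF_base I B -> A g -> B g ->
  exists C, [/\ UF_base I C, C g & C `<=` A `&` B].
Proof.
move=> [f [e [_ ->]]] [f' [e' [_ ->]]].
move=> /UF_ball_sub[a a0 ha] /UF_ball_sub[b b0 hb].
have m0 : 0 < Num.min a b by rewrite lt_min a0.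
exists (UF_ball I g (Num.min a b)); split.
- by exists g, (Num.min a b).
- apply/UF_ballP; split; first by rewrite subrr; exact: ideal0.
  exists set0; first exact: mu_finite0.
  by exists 0 => // x _; rewrite subrr normr0.
- by rewrite subsetI; split; [apply: ha|apply: hb]; rewrite ge_min lexx ?orbT.
Qed.

End UF.

(* Alias of the ring of measurable functions carrying the topology with open
   base [UF_base mu I]; the measure is a parameter although the carrier does
   not depend on it. *)
Definition UF_space (d : measure_display) (T : measurableType d) (R : realType)
    (mu : {measure set T -> \bar R}) (I : ideal {mfun T >-> R}) : Type :=
  {mfun T >-> R}.

Section UF_topology.
Context (d : measure_display) (T : measurableType d) (R : realType).
Variables (mu : {measure set T -> \bar R}) (I : ideal {mfun T >-> R}).

HB.instance Definition _ := GRing.ComNzRing.on (UF_space mu I).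

HB.instance Definition _ :=
  @isBaseTopological.Build (UF_space mu I)
    (set {mfun T >-> R}) (UF_base mu I) id
    (UF_base_cover mu I) (@UF_base_join _ _ _ mu I).

End UF_topology.

(* Main.v *)
(* An additive subgroup that contains a ball centred at 0 is clopen, since it
   and its complement are unions of cosets. Every subgroup containing [I], and
   [I `&` LinftyF mu] itself, contains such a ball. Conversely, for [f] in
   [I `&` LinftyF mu] the line [t |-> t * f] is continuous, because
   [|s f - t f| <= |s - t| M] off a mu-finite set; it joins 0 to [f]. *)

Require Import Defs.
From HB Require Import structures.
From mathcomp Require Import all_boot all_order all_algebra.
From mathcomp Require Import all_classical all_reals all_analysis measurable_realfun.

Import Order.TTheory GRing.Theory Num.Theory.
Import numFieldNormedType.Exports.

Local Open Scope classical_set_scope.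
Local Open Scope ring_scope.

(** A connected set through [x] meets [C] in a nonempty trace that is both open and closed in it, so
    the trace is the whole set. *)
Lemma connected_component_sub_clopen (X : topologicalType) (A C : set X) x :
  clopen C -> C x -> connected_component A x `<=` C.
Proof.
move=> [oC cC] Cx y [B [Bx _ Bconn] By].
suff BC : B `&` C = B by move: By; rewrite -BC => -[].
by apply: Bconn; [exists x | exists C | exists C].
Qed.

Section UF_topology.
Context (d : measure_display) (T : measurableType d) (R : realType).
Variables (mu : {measure set T -> \bar R}) (I : ideal {mfun T >-> R}).
Implicit Types f g : {mfun T >-> R}.

(** Trades the filter form of boundedness for one explicit bound, positive so that
    [UF_line_continuous] can divide by it. *)
Lemma weakly_ess_boundedP f : weakly_ess_bounded mu f <->
  exists2 E, mu_finite mu E &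
    exists2 M, 0 < M & forall x, ~ E x -> `|f x| <= M.
Proof.
split=> -[E Efin].
  by move=> /ex_strict_bound_gt0[M M0 fM]; exists E => //; exists M => // x /fM/ltW.
move=> [M M0 fM]; exists E => //; exists M; split; first exact: num_real.
by move=> N /ltW MN x /fM /le_trans; exact.
Qed.

Lemma UF_ball_center f (eps : R) : 0 < eps -> UF_ball mu I f eps f.
Proof.
move=> e0; apply/UF_ballP; split; first by rewrite subrr; exact: ideal0.
exists set0; first exact: mu_finite0.
by exists 0 => // x _; rewrite subrr normr0.
Qed.

(** Base sets may be centred anywhere; [UF_ball_sub] recentres them at a given point. *)
Lemma UF_openP (U : set (UF_space mu I)) : open U <->
  forall f, U f -> exists2 eps : R, 0 < eps & UF_ball mu I f eps `<=` U.
Proof.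
split=> [[D D_base <-] f [B DB Bf]|U_ball].
  have [g [eps [_ Beq]]] := D_base _ DB.
  move: Bf; rewrite /= Beq => /UF_ball_sub[del del0 sub].
  exists del => // h gh; exists B => //; rewrite Beq.
  exact: sub gh.
exists [set B | UF_base mu I B /\ B `<=` U]; first by move=> B [].
apply/seteqP; split=> [f [B [_ BU] /BU]//|f /U_ball[eps eps0 sub]].
exists (UF_ball mu I f eps); last exact: UF_ball_center.
by split=> //; exists f, eps.
Qed.

Lemma UF_clopen_subgroup (G : set (UF_space mu I)) (eps : R) :
  0 < eps -> zmod_closed (mem G) -> UF_ball mu I 0 eps `<=` G -> clopen G.
Proof.
move=> eps0 [/set_mem G0 Gz] sub.
have GB f g : G f -> G g -> G (f - g).
  by move=> Gf Gg; apply: set_mem; apply: Gz; exact: mem_set.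
(* By translation, [g - f] lies in the ball about 0, so one radius [eps] serves at every centre. *)
have ballG f g : UF_ball mu I f eps g -> G (f - g).
  move=> /UF_ballP[Ifg [E Efin [s s_lt fg]]].
  rewrite -[X in G X]opprK -[X in G X]sub0r; apply: GB => //; apply: sub.
  apply/UF_ballP; split; first by rewrite sub0r opprK.
  exists E => //; exists s => // x /fg.
  by rewrite /= sub0r opprK.
split.
  apply/UF_openP => f Gf; exists eps => // g /ballG Gfg.
  by rewrite -[g](subKr f); exact: GB.
rewrite -openC; apply/UF_openP => f nGf; exists eps => // g /ballG Gfg Gg.
(* Only differences are known to stay in [G], so [f] is written as [(f - g) - (0 - g)]. *)
apply: nGf; rewrite -(subrK g f) -[X in _ + X]opprK -[X in _ - X]sub0r.
by apply: (GB) => //; exact: GB.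
Qed.

Lemma zmod_closed_setI_LinftyF :
  zmod_closed (mem (I `&` LinftyF mu : set (UF_space mu I))).
Proof.
split=> [|f g /set_mem[If bf] /set_mem[Ig bg]]; apply: mem_set.
  split; first exact: ideal0.
  apply/weakly_ess_boundedP; exists set0; first exact: mu_finite0.
  by exists 1 => // x _; rewrite normr0.
split; first by rewrite -mulN1r; apply: idealD => //; exact: idealM.
move/weakly_ess_boundedP: bf => [E Efin [M M0 fM]].
move/weakly_ess_boundedP: bg => [F Ffin [N N0 gN]].
apply/weakly_ess_boundedP; exists (E `|` F); first exact: mu_finiteU.
exists (M + N); first exact: addr_gt0.
move=> x /not_orP[nEx nFx].
by rewrite (le_trans (ler_normB _ _))// lerD// ?fM ?gN.
Qed.

Lemma UF_ball0_sub (eps : R) :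
  0 < eps -> UF_ball mu I 0 eps `<=` I `&` LinftyF mu.
Proof.
move=> eps0 f /UF_ballP[If [E Efin [s s_lt fs]]]; split.
  by rewrite -[X in ideal_set _ X]opprK -mulN1r; apply: idealM; rewrite -sub0r.
(* The bound is [eps] because [s] need not be positive. *)
apply/weakly_ess_boundedP; exists E => //; exists eps => // x /fs.
by rewrite /= sub0r normrN => /le_trans; apply; exact: ltW.
Qed.

Lemma UF_line_continuous f : (I `&` LinftyF mu) f ->
  continuous (fun t : R => (cst t : {mfun T >-> R}) * f : UF_space mu I).
Proof.
move=> [If /weakly_ess_boundedP[E Efin [M M0 fM]]] s U.
rewrite nbhsE => -[V [/UF_openP oV /oV[eps eps0 sub]] VU].
(* This radius gives [|s - t| * M <= eps / 2] off [E], a bound strictly below [eps] and independent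
   of [t]. *)
apply/nbhs_ballP; exists (eps / 2 / M) => /=; first by rewrite !divr_gt0.
move=> t st; apply/VU/sub/UF_ballP; split.
  by rewrite -mulrBl; exact: idealM.
exists E => //; exists (eps / 2); first by rewrite gtr_pMr// invf_lt1// ltr1n.
move=> x /fM fxM /=; rewrite -mulrBl normrM.
have -> : eps / 2 = eps / 2 / M * M by rewrite divfK// gt_eqF.
by rewrite ler_pM// ltW.
Qed.

Lemma UF_connected_component0 :
  I `&` LinftyF mu `<=` connected_component [set: UF_space mu I] 0.
Proof.
move=> f If.
pose line (t : R) : UF_space mu I := (cst t : {mfun T >-> R}) * f.
exists (range line); last first.
  by exists 1 => //; apply/mfuneqP => x /=; rewrite mul1r.
split=> //.
  by exists 0 => //; apply/mfuneqP => x /=; rewrite mul0r.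
(* The range is connected as the continuous image of the interval [R]. *)
apply: connected_continuous_connected; first exact/connected_intervalP.
by apply: continuous_subspaceT; exact: UF_line_continuous.
Qed.

End UF_topology.

Theorem theorem6p16 (d : measure_display) (T : measurableType d) (R : realType)
    (mu : {measure set T -> \bar R}) (muT : mu [set: T] = +oo%E)
    (I : ideal {mfun T >-> R}) :
  [/\ forall G : set (UF_space mu I),
        zmod_closed (mem G) -> I `<=` G -> clopen G,
      clopen (I `&` LinftyF mu : set (UF_space mu I)) &
      connected_component [set: UF_space mu I] 0 = I `&` LinftyF mu].
Proof.
(* Serves both as (2) and, since the set contains 0, as the upper bound for the component in (3).
   The radius 1 is arbitrary: every ball about 0 lies in this set. *)
have clopenIL : clopen (I `&` LinftyF mu : set (UF_space mu I)).
  apply: (@UF_clopen_subgroup _ _ _ _ _ _ 1) => //.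
    exact: zmod_closed_setI_LinftyF.
  exact: UF_ball0_sub.
split=> // [G Gz IG|].
  apply: (@UF_clopen_subgroup _ _ _ _ _ _ 1) => //.
  by move=> f /UF_ball0_sub[]// /IG.
apply/seteqP; split; last exact: UF_connected_component0.
apply: connected_component_sub_clopen => //.
by have [/set_mem] := @zmod_closed_setI_LinftyF _ _ _ mu I.
Qed.
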